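(* Let $\Lambda$ be a row-finite $k$-graph with no sources and let $A$ be a locally compact abelian group. Suppose that $\mathcal{P}$ is a subset of $\Lambda\mathbin{{}_s*_s}\Lambda$ such that $\{Z(\mu,\nu):(\mu,\nu)\in\mathcal{P}\}$ is a partition of $\mathcal{G}_\Lambda$. Fix $c\in\underline{Z}^2(\Lambda,A)$, and let $\sigma_c\in\tilde Z^2(\mathcal{G}_\Lambda,A)$ be the continuous groupoid $2$-cocycle constructed from $c$ and $\mathcal{P}$. The cohomology class $[\sigma_c]\in\tilde H^2(\mathcal{G}_\Lambda,A)$ is independent of the choice of $\mathcal{P}$ and depends only on the cohomology class of $c$. Moreover, $[c]\mapsto[\sigma_c]$ is a homomorphism $\underline{H}^2(\Lambda,A)\to\tilde H^2(\mathcal{G}_\Lambda,A)$.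
   Context: $k$-graphs. For a nonnegative integer $k$, a $k$-graph is a nonempty countable small category $\Lambda$ with a functor $d:\Lambda\to\mathbb{N}^k$ (the degree; $0\in\mathbb{N}$) with the factorisation property: whenever $d(\lambda)=m+n$ with $m,n\in\mathbb N^k$ there are unique $\mu,\nu\in\Lambda$ with $d(\mu)=m$, $d(\nu)=n$, $\lambda=\mu\nu$. Write $\Lambda^n=d^{-1}(n)$. The set $\Lambda^0$ is identified with the set of objects (identity morphisms), and $r,s:\Lambda\to\Lambda^0$ are codomain and domain. Put $v\Lambda^n=\{\lambda\in\Lambda^n:r(\lambda)=v\}$; $\Lambda$ is row-finite if every $v\Lambda^n$ is finite, and has no sources if every $v\Lambda^n$ is nonempty. $\Lambda\mathbin{{}_s*_s}\Lambda=\{(\mu,\nu)\in\Lambda\times\Lambda:s(\mu)=s(\nu)\}$. Categorical cohomology. For $r\ge1$, $\Lambda^{*r}$ is the set of composable $r$-tuples; $\underline{C}^r(\Lambda,A)$ is the group of functions $\Lambda^{*r}\to A$ vanishing whenever some entry is in $\Lambda^0$. $\underline{Z}^2(\Lambda,A)$ is the group of $c\in\underline{C}^2(\Lambda,A)$ with $c(\lambda_1,\lambda_2)+c(\lambda_1\lambda_2,\lambda_3)=c(\lambda_2,\lambda_3)+c(\lambda_1,\lambda_2\lambda_3)$; $\underline{B}^2$ is the set of $\underline{\delta}^1b$, $b\in\underline{C}^1(\Lambda,A)$, where $(\underline{\delta}^1b)(\mu,\nu)=b(\mu)-b(\mu\nu)+b(\nu)$; $\underline{H}^2=\underline{Z}^2/\underline{B}^2$.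 Path groupoid. $\Omega_k=\{(m,n)\in\mathbb{N}^k\times\mathbb N^k:m\le n\}$ is the $k$-graph with $r(m,n)=m$, $s(m,n)=n$, $(m,n)(n,p)=(m,p)$, $d(m,n)=n-m$. $\Lambda^\infty$ is the set of degree-preserving functors $x:\Omega_k\to\Lambda$; $r(x)=x(0)$; $(\sigma^px)(m,n)=x(m+p,n+p)$; for $\lambda\in\Lambda$, $x\in\Lambda^\infty$ with $s(\lambda)=r(x)$, $\lambda x\in\Lambda^\infty$ is the unique element with $(\lambda x)(0,d(\lambda))=\lambda$ and $\sigma^{d(\lambda)}(\lambda x)=x$. $\mathcal{G}_\Lambda=\{(x,\ell-m,y)\in\Lambda^\infty\times\mathbb{Z}^k\times\Lambda^\infty:\ell,m\in\mathbb{N}^k,\sigma^\ell x=\sigma^my\}$ with $r(x,n,y)=(x,0,x)$, $s(x,n,y)=(y,0,y)$, $(x,n,y)(y,p,z)=(x,n+p,z)$. The sets $Z(\mu,\nu)=\{(\mu x,d(\mu)-d(\nu),\nu x):x\in\Lambda^\infty,r(x)=s(\mu)\}$, $(\mu,\nu)\in\Lambda\mathbin{{}_s*_s}\Lambda$, form a basis of compact open sets for a locally compact Hausdorff topology making $\mathcal{G}_\Lambda$ an étale groupoid. Continuous cocycle cohomology. $\tilde C^n(\mathcal{G},A)$ is the group of continuous functions from composable $n$-tuples in $\mathcal{G}$ to $A$ which vanish whenever some entry is a unit. $\tilde Z^2(\mathcal{G},A)$ is the set of $\sigma\in\tilde C^2(\mathcal{G},A)$ with $\sigma(g_1,g_2)+\sigma(g_1g_2,g_3)=\sigma(g_2,g_3)+\sigma(g_1,g_2g_3)$;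 $\tilde B^2$ is the set of $(g,h)\mapsto a(g)-a(gh)+a(h)$, $a\in\tilde C^1(\mathcal{G},A)$; $\tilde H^2=\tilde Z^2/\tilde B^2$. The cocycle $\sigma_c$. Given $c$ and $\mathcal{P}$ as in the claim, for $g\in\mathcal{G}_\Lambda$ let $(\mu_g,\nu_g)$ be the unique element of $\mathcal{P}$ with $g\in Z(\mu_g,\nu_g)$. For composable $(g,h)$ there exist $\alpha\in s(\mu_g)\Lambda$, $\beta\in s(\mu_h)\Lambda$, $\gamma\in s(\mu_{gh})\Lambda$ (where $v\Lambda=\{\lambda:r(\lambda)=v\}$) and $y\in\Lambda^\infty$ with $r(y)=s(\alpha)=s(\beta)=s(\gamma)$, $\mu_g\alpha=\mu_{gh}\gamma$, $\nu_h\beta=\nu_{gh}\gamma$, $\nu_g\alpha=\mu_h\beta$, and $g=(\mu_g\alpha y,d(\mu_g)-d(\nu_g),\nu_g\alpha y)$, $h=(\mu_h\beta y,d(\mu_h)-d(\nu_h),\nu_h\beta y)$, $gh=(\mu_{gh}\gamma y,d(\mu_{gh})-d(\nu_{gh}),\nu_{gh}\gamma y)$. Then $\sigma_c(g,h):=(c(\mu_g,\alpha)-c(\nu_g,\alpha))+(c(\mu_h,\beta)-c(\nu_h,\beta))-(c(\mu_{gh},\gamma)-c(\nu_{gh},\gamma))$ is independent of the choice of $\alpha,\beta,\gamma$, and $\sigma_c\in\tilde Z^2(\mathcal{G}_\Lambda,A)$. *)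

(* Defs.v *)
From HB Require Import structures.
From mathcomp Require Import all_boot all_order all_algebra.
From mathcomp Require Import all_classical all_reals all_analysis.

Set Implicit Arguments.
Unset Strict Implicit.
Unset Printing Implicit Defensive.

Import GRing.Theory.

Local Open Scope classical_set_scope.
Local Open Scope ring_scope.
Local Open Scope quotient_scope.

(* [comp] is total; its value [comp f g] is constrained, and used, only when
   [src f = rng g]. *)
Record category := Category {
  obj : Type;
  mor :> Type;
  rng : mor -> obj;
  src : mor -> obj;
  idm : obj -> mor;
  comp : mor -> mor -> mor;
  rng_idm : forall v, rng (idm v) = v;
  src_idm : forall v, src (idm v) = v;
  rng_comp : forall f g, src f = rng g -> rng (comp f g) = rng f;
  src_comp : forall f g, src f = rng g -> src (comp f g) = src g;
  comp_idl : forall f, comp (idm (rng f)) f = f;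
  comp_idr : forall f, comp f (idm (src f)) = f;
  comp_assoc : forall f g h, src f = rng g -> src g = rng h ->
    comp (comp f g) h = comp f (comp g h) }.

Arguments idm {c}.

HB.instance Definition _ (C : category) := gen_eqMixin (mor C).
HB.instance Definition _ (C : category) := gen_choiceMixin (mor C).

Record functor (C D : category) := Functor {
  fobj : obj C -> obj D;
  fmor :> mor C -> mor D;
  functor_rng : forall f, rng (fmor f) = fobj (rng f);
  functor_src : forall f, src (fmor f) = fobj (src f);
  functor_idm : forall v, fmor (idm v) = idm (fobj v);
  functor_comp : forall f g, src f = rng g ->
    fmor (comp f g) = comp (fmor f) (fmor g) }.

Lemma functor_eq (C D : category) (F G : functor C D) :
  fobj F = fobj G -> fmor F = fmor G -> F = G.
Proof.
case: F => Fo Fm a b c d; case: G => Go Gm a' b' c' d' /= eo em.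
subst Go Gm; rewrite (Prop_irrelevance a a') (Prop_irrelevance b b').
by rewrite (Prop_irrelevance c c') (Prop_irrelevance d d').
Qed.

Notation natvec k := {ffun 'I_k -> nat}.
Notation intvec k := {ffun 'I_k -> int}.

Definition vle k (m n : natvec k) : bool := [forall i, (m i <= n i)%N].
Definition vsub k (n m : natvec k) : natvec k := [ffun i => (n i - m i)%N].
Definition vint k (n : natvec k) : intvec k := [ffun i => (n i)%:Z].

Record kgraph (k : nat) := KGraph {
  kcat :> category;
  deg : kcat -> natvec k;
  deg_idm : forall v, deg (idm v) = 0;
  deg_comp : forall f g, src f = rng g -> deg (comp f g) = deg f + deg g;
  factorisation : forall (l : kcat) (m n : natvec k), deg l = m + n ->
    exists! p : kcat * kcat,
      [/\ deg p.1 = m, deg p.2 = n, src p.1 = rng p.2 & l = comp p.1 p.2];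
  kgraph_countable : countable [set: kcat];
  kgraph_nonempty : [set: kcat] !=set0 }.

Definition row_finite k (L : kgraph k) : Prop :=
  forall (v : obj L) (n : natvec k),
    finite_set [set l : L | rng l = v /\ deg l = n].

Definition no_sources k (L : kgraph k) : Prop :=
  forall (v : obj L) (n : natvec k),
    [set l : L | rng l = v /\ deg l = n] !=set0.

Section Omega.
Variable k : nat.
Implicit Types m n p : natvec k.

Lemma vleP m n : reflect (forall i, (m i <= n i)%N) (vle m n).
Proof. exact: forallP. Qed.

Lemma vle_refl m : vle m m.
Proof. by apply/vleP. Qed.

Lemma vle_trans m n p : vle m n -> vle n p -> vle m p.
Proof.
by move=> /vleP mn /vleP np; apply/vleP => i; apply: leq_trans (np i).
Qed.

Lemma vle0 n : vle 0 n.
Proof. by apply/vleP => i; rewrite ffunE. Qed.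

Lemma vleD2r p m n : vle m n -> vle (m + p) (n + p).
Proof. by move=> /vleP mn; apply/vleP => i; rewrite !ffunE leq_add2r. Qed.

Lemma vle_addr m n : vle m (m + n).
Proof. by apply/vleP => i; rewrite ffunE leq_addr. Qed.

Lemma vaddE m n i : (m + n) i = (m i + n i)%N.
Proof. by rewrite ffunE. Qed.

Definition omega_mor : Type := {p : natvec k * natvec k | vle p.1 p.2}.

Definition om m n (h : vle m n) : omega_mor := exist _ (m, n) h.

Definition omega_rng (f : omega_mor) := (val f).1.
Definition omega_src (f : omega_mor) := (val f).2.
Definition omega_id m : omega_mor := om (vle_refl m).
Definition omega_comp (f g : omega_mor) : omega_mor :=
  insubd f (omega_rng f, omega_src g).
Definition omega_deg (f : omega_mor) : natvec k :=
  vsub (omega_src f) (omega_rng f).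

Lemma val_omega_comp f g : omega_src f = omega_rng g ->
  val (omega_comp f g) = (omega_rng f, omega_src g).
Proof.
move=> fg; rewrite val_insubd ifT//=.
apply: (vle_trans (valP f)); rewrite -/(omega_src f) fg; exact: (valP g).
Qed.

Lemma omega_rng_comp f g : omega_src f = omega_rng g ->
  omega_rng (omega_comp f g) = omega_rng f.
Proof. by move=> fg; rewrite {1}/omega_rng val_omega_comp. Qed.

Lemma omega_src_comp f g : omega_src f = omega_rng g ->
  omega_src (omega_comp f g) = omega_src g.
Proof. by move=> fg; rewrite {1}/omega_src val_omega_comp. Qed.

Lemma omega_comp_idl f : omega_comp (omega_id (omega_rng f)) f = f.
Proof. by apply: val_inj; rewrite val_omega_comp//; case: f => -[]. Qed.

Lemma omega_comp_idr f : omega_comp f (omega_id (omega_src f)) = f.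
Proof. by apply: val_inj; rewrite val_omega_comp//; case: f => -[]. Qed.

Lemma omega_assoc f g h : omega_src f = omega_rng g ->
  omega_src g = omega_rng h ->
  omega_comp (omega_comp f g) h = omega_comp f (omega_comp g h).
Proof.
move=> fg gh; apply: val_inj; rewrite !val_omega_comp ?omega_src_comp//.
  by rewrite omega_rng_comp.
by rewrite omega_rng_comp.
Qed.

Definition omega_cat : category :=
  @Category (natvec k) omega_mor omega_rng omega_src omega_id omega_comp
    (fun=> erefl) (fun=> erefl) omega_rng_comp omega_src_comp
    omega_comp_idl omega_comp_idr omega_assoc.

Lemma omega_degK f : omega_src f = omega_rng f + omega_deg f.
Proof.
by apply/ffunP => i; rewrite vaddE ffunE subnKC//; move/vleP: (valP f).
Qed.

Lemma vaddI m n p : m + n = m + p -> n = p.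
Proof.
move=> /ffunP E; apply/ffunP => i; move: (E i); rewrite !vaddE.
by move/eqP; rewrite eqn_add2l => /eqP.
Qed.

Lemma omega_deg_id m : omega_deg (omega_id m) = 0.
Proof. by apply/ffunP => i; rewrite !ffunE subnn. Qed.

Lemma omega_deg_comp f g : omega_src f = omega_rng g ->
  omega_deg (omega_comp f g) = omega_deg f + omega_deg g.
Proof.
move=> fg; apply: (@vaddI (omega_rng f)).
rewrite addrA -omega_degK fg -omega_degK -(omega_src_comp fg).
by rewrite -{1}(omega_rng_comp fg) -omega_degK.
Qed.

Lemma omega_factorisation (f : omega_cat) m n : omega_deg f = m + n ->
  exists! p : omega_cat * omega_cat,
    [/\ omega_deg p.1 = m, omega_deg p.2 = n,
        omega_src p.1 = omega_rng p.2 & f = omega_comp p.1 p.2].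
Proof.
move=> fmn.
have srcf : omega_src f = omega_rng f + m + n by rewrite omega_degK fmn addrA.
have h2 : vle (omega_rng f + m) (omega_src f) by rewrite srcf vle_addr.
have h1 := vle_addr (omega_rng f) m.
exists (om h1, om h2); split=> /=.
  have fE : f = omega_comp (om h1) (om h2).
    by apply: val_inj; rewrite val_omega_comp//=; exact: surjective_pairing.
  split=> //.
    apply: (@vaddI (omega_rng f)).
    by rewrite -[X in X + omega_deg _]/(omega_rng (om h1)) -omega_degK.
  apply: (@vaddI (omega_rng f + m)).
  by rewrite -[X in X + omega_deg _]/(omega_rng (om h2)) -omega_degK.
move=> [g h] /= [gm hn gh fE].
have rg : omega_rng g = omega_rng f by rewrite fE omega_rng_comp.
have sh : omega_src h = omega_src f by rewrite fE omega_src_comp.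
have sg : omega_src g = omega_rng f + m by rewrite omega_degK gm rg.
congr pair; apply: val_inj => /=.
  by rewrite [RHS]surjective_pairing -/(omega_rng g) -/(omega_src g) rg sg.
by rewrite [RHS]surjective_pairing -/(omega_rng h) -/(omega_src h) -gh sh sg.
Qed.

Lemma omega_countable : countable [set: omega_cat].
Proof. exact: (@countableP {p : natvec k * natvec k | vle p.1 p.2}). Qed.

Lemma omega_nonempty : [set: omega_cat] !=set0.
Proof. by exists (omega_id 0). Qed.

Definition Omega : kgraph k :=
  @KGraph k omega_cat omega_deg omega_deg_id omega_deg_comp
    omega_factorisation omega_countable omega_nonempty.

Definition omega_shift p (f : Omega) : Omega := om (vleD2r p (valP f)).

End Omega.

Record infpath k (L : kgraph k) := InfPath {
  pfun :> functor (Omega k) L;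
  infpath_deg : forall f, deg (pfun f) = deg f }.

HB.instance Definition _ k (L : kgraph k) := gen_eqMixin (infpath L).
HB.instance Definition _ k (L : kgraph k) := gen_choiceMixin (infpath L).

Section InfPath.
Variables (k : nat) (L : kgraph k).
Implicit Types (x y : infpath L) (n p : natvec k).

Definition prng x : obj L := fobj x (0 : natvec k).

Section Shift.
Variables (p : natvec k) (x : infpath L).

Let sobj (m : obj (Omega k)) : obj L := fobj x ((m : natvec k) + p).
Let smor (f : Omega k) : L := x (omega_shift p f).

Let smor_rng f : rng (smor f) = sobj (rng f).
Proof. by rewrite /smor functor_rng. Qed.

Let smor_src f : src (smor f) = sobj (src f).
Proof. by rewrite /smor functor_src. Qed.

Let smor_idm v : smor (idm v) = idm (sobj v).
Proof.
by rewrite /smor /sobj -functor_idm; congr (fmor x _); exact: val_inj.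
Qed.

Let smor_comp f g : src f = rng g -> smor (comp f g) = comp (smor f) (smor g).
Proof.
move=> fg.
have fg' : omega_src (omega_shift p f) = omega_rng (omega_shift p g).
  by rewrite /omega_src /omega_rng /= -/(omega_src f) [omega_src f]fg.
rewrite /smor -functor_comp//; congr (fmor x _); apply: val_inj.
by rewrite [RHS]val_omega_comp//= val_omega_comp.
Qed.

Let smor_deg f : deg (Functor smor_rng smor_src smor_idm smor_comp f) = deg f.
Proof.
by rewrite /= /smor infpath_deg; apply/ffunP => i; rewrite !ffunE subnDr.
Qed.

Definition pshift : infpath L := InfPath smor_deg.

End Shift.

(* [prepend l x] is the infinite path lx; it is meaningful when
   [src l = prng x], in which case exactly one [u] meets the condition. *)
Definition prepend (l : L) x : infpath L :=
  xget x [set u : infpath L |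
    u (om (vle0 (deg l))) = l /\ pshift (deg l) u = x].

End InfPath.

Section ShiftTheory.
Variables (k : nat) (L : kgraph k).
Implicit Types (x : infpath L) (p q : natvec k).

Lemma infpath_eq x (y : infpath L) :
  fobj x = fobj y -> fmor x = fmor y -> x = y.
Proof.
case: x => F dF; case: y => H dH eo em.
have FH : F = H by exact: functor_eq.
subst H.
by rewrite (Prop_irrelevance dF dH).
Qed.

Lemma pshiftD p q x : pshift p (pshift q x) = pshift (p + q) x.
Proof.
apply: infpath_eq; apply/funext => f /=; first by rewrite addrA.
by congr (fmor x _); apply: val_inj; rewrite /= !addrA.
Qed.

End ShiftTheory.

Section PathGroupoid.
Variables (k : nat) (L : kgraph k).

Definition gtriple : Type := (infpath L * intvec k * infpath L)%type.
HB.instance Definition _ := Choice.on gtriple.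

Definition gtriple_in : set gtriple := [set t | exists l m : natvec k,
  t.1.2 = vint l - vint m /\ pshift l t.1.1 = pshift m t.2].

Record pgroupoid := PGroupoid {
  gval :> gtriple;
  gvalP : gval \in gtriple_in }.

HB.instance Definition _ := [isSub for gval].
HB.instance Definition _ := [Choice of pgroupoid by <:].

Implicit Types g h : pgroupoid.

Definition gfst g : infpath L := (gval g).1.1.
Definition gdeg g : intvec k := (gval g).1.2.
Definition glst g : infpath L := (gval g).2.

Lemma gunit_subproof (x : infpath L) : (x, 0, x) \in gtriple_in.
Proof. by rewrite inE; exists 0, 0; rewrite subrr. Qed.

Definition gunit x : pgroupoid := PGroupoid (gunit_subproof x).

Definition grng g : pgroupoid := gunit (gfst g).
Definition gsrc g : pgroupoid := gunit (glst g).
Definition is_gunit g : Prop := exists x, g = gunit x.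

Definition gcomposable : set (pgroupoid * pgroupoid) :=
  [set gh | gsrc gh.1 = grng gh.2].

Lemma gmul_subproof g h : glst g = gfst h ->
  (gfst g, gdeg g + gdeg h, glst h) \in gtriple_in.
Proof.
have := gvalP g; have := gvalP h; rewrite !inE.
move=> -[l' [m' [hd hs]]] [l [m [gd gs]]] gh.
exists (l' + l), (m + m'); split=> /=.
  rewrite /gdeg hd gd; apply/ffunP => i; rewrite !ffunE !PoszD.
  by rewrite addrACA -opprD [X in X - _]addrC.
rewrite -!pshiftD [pshift l _]gs -[pshift m' _]hs.
by rewrite -/(gfst h) -gh !pshiftD addrC.
Qed.

(* Used only on composable pairs, where the triple belongs to the groupoid by
   [gmul_subproof]; otherwise [insubd] may return the default [g]. *)
Definition gmul g h : pgroupoid := insubd g (gfst g, gdeg g + gdeg h, glst h).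

Definition cyl (p : L * L) : set pgroupoid :=
  [set g | exists x : infpath L, prng x = src p.1 /\
     gval g = (prepend p.1 x, vint (deg p.1) - vint (deg p.2), prepend p.2 x)].

(* The sets [cyl p] form a basis, so the topology they generate as a subbase
   is the one having them as a basis. *)
HB.instance Definition _ := @isSubBaseTopological.Build pgroupoid
  (set pgroupoid) [set cyl p | p in [set p | src p.1 = src p.2]] id.

(* The partition is indexed by P: distinct elements of P have disjoint
   cylinders, so that each g lies in [cyl p] for a unique p in P. *)
Definition cyl_partition (P : set (L * L)) : Prop :=
  P `<=` [set p | src p.1 = src p.2] /\ partition P cyl [set: pgroupoid].

End PathGroupoid.

Fact fct_subE (T : Type) (A : zmodType) (f g : T -> A) x :
  (f - g) x = f x - g x.
Proof. by []. Qed.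

Fact fct_0E (T : Type) (A : zmodType) (x : T) : (0 : T -> A) x = 0.
Proof. by []. Qed.

Section CategoricalCohomology.
Variables (k : nat) (L : kgraph k) (A : zmodType).

Definition catC1 : set (L -> A) := [set b | forall l, deg l = 0 -> b l = 0].

(* Functions on composable pairs are represented by their extension by zero
   to all pairs. *)
Definition catC2 : set (L * L -> A) := [set c |
  (forall m n, src m <> rng n -> c (m, n) = 0) /\
  (forall m n, src m = rng n -> deg m = 0 \/ deg n = 0 -> c (m, n) = 0)].

Definition catZ2 : set (L * L -> A) := [set c | catC2 c /\
  forall l1 l2 l3, src l1 = rng l2 -> src l2 = rng l3 ->
    c (l1, l2) + c (comp l1 l2, l3) = c (l2, l3) + c (l1, comp l2 l3)].

Definition catd1 (b : L -> A) : L * L -> A := fun p =>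
  if `[< src p.1 = rng p.2 >] then b p.1 - b (comp p.1 p.2) + b p.2 else 0.

Definition catB2 : set (L * L -> A) := catd1 @` catC1.

Definition catcocycle2_pred : {pred L * L -> A} := fun c => c \in catZ2.

Fact catZ2_subproof : zmod_closed catcocycle2_pred.
Proof.
split=> [|c c']; rewrite unfold_in /= ?inE.
  by split=> [|*]; rewrite ?addr0.
move=> [[c0 cu] cc] [[c0' cu'] cc']; split.
  by split=> m n *; rewrite fct_subE; [rewrite c0// c0'//|rewrite cu// cu'//];
    rewrite subr0.
by move=> *; rewrite !fct_subE addrACA -opprD cc// cc'// opprD addrACA.
Qed.
HB.instance Definition _ :=
  GRing.isZmodClosed.Build _ catcocycle2_pred catZ2_subproof.

Record catcocycle2 := CatCocycle2 {
  catcocycle2_fun :> L * L -> A;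
  catcocycle2P : catcocycle2_fun \in catcocycle2_pred }.

HB.instance Definition _ := [isSub for catcocycle2_fun].
HB.instance Definition _ := [Choice of catcocycle2 by <:].
HB.instance Definition _ := [SubChoice_isSubZmodule of catcocycle2 by <:].

Definition catcoboundary2 : {pred catcocycle2} :=
  fun c => (c : L * L -> A) \in catB2.

Fact catcoboundary2_subproof : zmod_closed catcoboundary2.
Proof.
split=> [|c c']; rewrite unfold_in /= ?inE.
  exists 0; first by [].
  apply/funext => p.
  by rewrite /catd1 !fct_0E subr0 addr0 if_same.
move=> [b b0 e] [b' b0' e']; exists (b - b').
  by move=> l l0; rewrite !fct_subE b0// b0'// subr0.
have -> : catcocycle2_fun (c - c') =
  catcocycle2_fun c - catcocycle2_fun c' by [].
rewrite -e -e'; apply/funext => p.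
rewrite fct_subE /catd1 !fct_subE; case: ifP => _; last by rewrite subr0.
by rewrite !opprD !opprK [RHS]addrACA; congr (_ + _); rewrite addrACA.
Qed.
HB.instance Definition _ :=
  GRing.isZmodClosed.Build _ catcoboundary2 catcoboundary2_subproof.

Definition catH2 := Quotient.quot catcoboundary2.
HB.instance Definition _ := GRing.Zmodule.on catH2.

Definition catclass (c : catcocycle2) : catH2 := \pi_catH2 c.

End CategoricalCohomology.

Section GroupoidCohomology.
Variables (k : nat) (L : kgraph k) (A : topologicalZmodType).
Local Notation G := (pgroupoid L).

Definition gpdC1 : set (G -> A) := [set a |
  continuous a /\ forall g, is_gunit g -> a g = 0].

(* As in [catC2], functions on composable pairs are extended by zero. *)
Definition gpdC2 : set (G * G -> A) := [set f |
  [/\ {within @gcomposable k L, continuous f},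
      forall g h, ~ gcomposable (g, h) -> f (g, h) = 0 &
      forall g h, gcomposable (g, h) -> is_gunit g \/ is_gunit h ->
        f (g, h) = 0]].

Definition gpdZ2 : set (G * G -> A) := [set f | gpdC2 f /\
  forall g1 g2 g3, gcomposable (g1, g2) -> gcomposable (g2, g3) ->
    f (g1, g2) + f (gmul g1 g2, g3) = f (g2, g3) + f (g1, gmul g2 g3)].

Definition gpdd1 (a : G -> A) : G * G -> A := fun p =>
  if `[< gcomposable p >] then a p.1 - a (gmul p.1 p.2) + a p.2 else 0.

Definition gpdB2 : set (G * G -> A) := gpdd1 @` gpdC1.

Fact cvgB_topZmod (T : topologicalType) (F : set_system T) (f g : T -> A)
    (a b : A) : Filter F ->
  f @ F --> a -> g @ F --> b -> (fun x => f x - g x) @ F --> a - b.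
Proof.
move=> FF fa gb.
apply: (@continuous2_cvg _ _ _ _ F FF f g (fun u v => u - v) a b) => //.
exact: (@sub_continuous A (a, b)).
Qed.

Definition gpdcocycle2_pred : {pred G * G -> A} := fun c => c \in gpdZ2.

Fact continuousB_topZmod (T : topologicalType) (f g : T -> A) :
  continuous f -> continuous g -> continuous (f - g).
Proof. by move=> cf cg x; apply: cvgB_topZmod; [exact: cf|exact: cg]. Qed.

Fact gpdZ2_subproof : zmod_closed gpdcocycle2_pred.
Proof.
split=> [|c c']; rewrite unfold_in /= ?inE.
  split=> [|*]; rewrite ?addr0//.
  by split=> // x; apply: cvg_cst.
move=> [[cc c0 cu] cE] [[cc' c0' cu'] cE']; split.
  split=> [x|m n *|m n *].
  - by apply: cvgB_topZmod; [exact: cc|exact: cc'].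
  - by rewrite !fct_subE c0// c0'// subr0.
  - by rewrite !fct_subE cu// cu'// subr0.
by move=> *; rewrite !fct_subE addrACA -opprD cE// cE'// opprD addrACA.
Qed.
HB.instance Definition _ :=
  GRing.isZmodClosed.Build _ gpdcocycle2_pred gpdZ2_subproof.

Record gpdcocycle2 := GpdCocycle2 {
  gpdcocycle2_fun :> G * G -> A;
  gpdcocycle2P : gpdcocycle2_fun \in gpdcocycle2_pred }.

HB.instance Definition _ := [isSub for gpdcocycle2_fun].
HB.instance Definition _ := [Choice of gpdcocycle2 by <:].
HB.instance Definition _ := [SubChoice_isSubZmodule of gpdcocycle2 by <:].

Definition gpdcoboundary2 : {pred gpdcocycle2} :=
  fun f => (f : G * G -> A) \in gpdB2.

Fact gpdcoboundary2_subproof : zmod_closed gpdcoboundary2.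
Proof.
split=> [|c c']; rewrite unfold_in /= ?inE.
  exists 0; first by split=> //; exact: (@cst_continuous _ _ (0 : A)).
  apply/funext => p.
  by rewrite /gpdd1 !fct_0E subr0 addr0 if_same.
move=> [b [bc b0] e] [b' [bc' b0'] e']; exists (b - b').
  split=> [|l l0]; last by rewrite !fct_subE b0// b0'// subr0.
  exact: (continuousB_topZmod bc bc').
have -> : gpdcocycle2_fun (c - c') =
  gpdcocycle2_fun c - gpdcocycle2_fun c' by [].
rewrite -e -e'; apply/funext => p.
rewrite fct_subE /gpdd1 !fct_subE; case: ifP => _; last by rewrite subr0.
by rewrite !opprD !opprK [RHS]addrACA; congr (_ + _); rewrite addrACA.
Qed.
HB.instance Definition _ :=
  GRing.isZmodClosed.Build _ gpdcoboundary2 gpdcoboundary2_subproof.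

Definition gpdH2 := Quotient.quot gpdcoboundary2.
HB.instance Definition _ := GRing.Zmodule.on gpdH2.

Definition gpdclass (f : gpdcocycle2) : gpdH2 := \pi_gpdH2 f.

End GroupoidCohomology.

Section SigmaC.
Variables (k : nat) (L : kgraph k) (A : zmodType).
Local Notation G := (pgroupoid L).

(* The default value is never used when P satisfies [cyl_partition]. *)
Definition pindex (P : set (L * L)) (g : G) : L * L :=
  xget (idm (prng (gfst g)), idm (prng (gfst g))) [set p | P p /\ cyl p g].

Definition gextends (g : G) (p : L * L) (a : L) (y : infpath L) : Prop :=
  gval g = (prepend (comp p.1 a) y, vint (deg p.1) - vint (deg p.2),
            prepend (comp p.2 a) y).

(* The value does not depend on the choice of [al], [be], [ga], [y]; the
   default 0 extends [sigma_c] by zero off the composable pairs. *)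
Definition sigma_c (P : set (L * L)) (c : L * L -> A) (gh : G * G) : A :=
  let g := gh.1 in let h := gh.2 in
  let p := pindex P g in let q := pindex P h in
  let w := pindex P (gmul g h) in
  xget 0 [set v | gcomposable (g, h) /\
    exists (al be ga : L) (y : infpath L),
    [/\ [/\ rng al = src p.1, rng be = src q.1 & rng ga = src w.1],
        [/\ prng y = src al, src al = src be & src be = src ga],
        [/\ comp p.1 al = comp w.1 ga, comp q.2 be = comp w.2 ga &
            comp p.2 al = comp q.1 be],
        [/\ gextends g p al y, gextends h q be y &
            gextends (gmul g h) w ga y] &
        v = (c (p.1, al) - c (p.2, al)) + (c (q.1, be) - c (q.2, be))
            - (c (w.1, ga) - c (w.2, ga))]].

End SigmaC.

(* Main.v *)
Require Import Defs.
From HB Require Import structures.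
From mathcomp Require Import all_boot all_order all_algebra.
From mathcomp Require Import all_classical all_reals all_analysis.

Import GRing.Theory.
Local Open Scope classical_set_scope.
Local Open Scope ring_scope.

Set Implicit Arguments.
Unset Strict Implicit.
Unset Printing Implicit Defensive.

(** The cocycle sigma_c becomes transparent when it is read off at levels.  A
    level of g = (x, n, y) is a pair (N, M) with N - M = n and
    sigma^N x = sigma^M y, and along a composable pair g, h a level (N, M) of g
    and a level (M, R) of h give the level (N, R) of gh.  Let (mu, nu) be the
    member of the partition whose cylinder contains g.  At a level with
    d(mu) <= N, put alpha = x(d(mu), N), which equals y(d(nu), M), and
    kappa_g(N, M) = c(mu, alpha) - c(nu, alpha).  The morphisms alpha, beta,
    gamma in the definition of sigma_c are exactly those attached to levels
    (N, M), (M, R), (N, R) of g, h and gh, so that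

      sigma_c(g, h) = kappa_g(N, M) + kappa_h(M, R) - kappa_gh(N, R).

    By the cocycle identity for c, replacing (N, M) by (N+e, M+e) changes
    kappa_g by D_x(N) - D_y(M), where D_x(N) = c(x(0,N), x(N,N+e)) does not
    refer to the partition ([kappaD]).  Such changes telescope along composable
    pairs, so the right-hand side is independent of the levels
    ([kappa3_indep], [sigma_cE]).  Everything else follows by choosing levels
    that are large enough for all the elements in play.

    - The cocycle identity for sigma_c: at one chain of levels
      (N0, N1, N2, N3), sigma_c is formally the coboundary of kappa.
    - Continuity: kappa is constant on the cylinder of g at a given level
      ([kappa_local]), so sigma_c is locally constant.
    - Two partitions: the difference of their functions kappa is independent of
      the level, because D_x is the same for both; it is a continuous 1-cochain
      whose coboundary is the difference of the two cocycles.
    - Cohomologous c: if c - c' is the coboundary of b, then the two functions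
      kappa differ by b(mu) - b(nu) plus terms that telescope, so that
      g |-> b(mu_g) - b(nu_g) is the required 1-cochain.
    - The homomorphism: kappa is additive in c.

    Levels can be compared with cylinders because the path lx exists and is
    unique; this holds as an infinite path amounts to a coherent family of
    initial segments. *)

(* The bare name would denote composition of functions. *)
Local Notation comp := Defs.comp.

(** * Degree vectors *)

Section Degrees.
Variable k : nat.
Implicit Types m n p : natvec k.

Lemma vsubK m n : vle m n -> m + vsub n m = n.
Proof. by move=> /vleP h; apply/ffunP => i; rewrite vaddE ffunE subnKC. Qed.

Lemma vsubDl m n : vsub (m + n) m = n.
Proof. by apply/ffunP => i; rewrite ffunE vaddE addKn. Qed.

Lemma vsubDr m n e : vle m n -> vsub (n + e) m = vsub n m + e.
Proof. by move=> h; rewrite -{1}(vsubK h) -addrA vsubDl. Qed.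

Lemma vle_addl m n : vle m (n + m).
Proof. by rewrite addrC vle_addr. Qed.

Lemma vle_add2 m n p : vle m n -> vle m (n + p).
Proof. by move=> h; apply: vle_trans h (vle_addr _ _). Qed.

Lemma vle_sum (s : seq (natvec k)) m : m \in s -> vle m (\sum_(n <- s) n).
Proof.
elim: s => //= n s IH; rewrite in_cons big_cons => /predU1P[->|/IH h].
  exact: vle_addr.
exact: vle_trans h (vle_addl _ _).
Qed.

Lemma vintD m n : vint (m + n) = vint m + vint n.
Proof. by apply/ffunP => i; rewrite !ffunE PoszD. Qed.

Lemma vint_inj : injective (@vint k).
Proof.
by move=> m n /ffunP h; apply/ffunP => i; move: (h i); rewrite !ffunE => -[].
Qed.

Lemma vint_subE m n m' n' :
  vint m - vint n = vint m' - vint n' <-> m + n' = m' + n.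
Proof.
split=> [h|/(congr1 (@vint k))]; last rewrite !vintD.
  apply: vint_inj; rewrite !vintD.
  by rewrite -[vint m](subrK (vint n)) h addrAC subrK.
by move=> h; apply/eqP; rewrite subr_eq addrAC -h addrK.
Qed.

End Degrees.

(** * Segments of infinite paths *)

Section Segments.
Variables (k : nat) (L : kgraph k).
Implicit Types (x y u : infpath L) (a b m n e : natvec k) (f g h l : L).

Lemma factor_inj f g f' g' : src f = rng g -> src f' = rng g' ->
  deg f = deg f' -> comp f g = comp f' g' -> f = f' /\ g = g'.
Proof.
move=> fg fg' ff' E.
have dg : deg g = deg g'.
  by apply: (@vaddI _ (deg f)); rewrite -deg_comp// E deg_comp// ff'.
have [q [_ U]] := factorisation (deg_comp fg).
have e1 := U (f, g) (And4 erefl erefl fg erefl).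
have e2 := U (f', g') (And4 (esym ff') (esym dg) fg' E).
by move: e2; rewrite e1 => -[-> ->].
Qed.

Lemma comp_cancel f g g' : src f = rng g -> src f = rng g' ->
  comp f g = comp f g' -> g = g'.
Proof. by move=> h h' E; case: (factor_inj h h' erefl E). Qed.

Lemma path_om x a b c d (h : vle a b) (h' : vle c d) :
  a = c -> b = d -> x (om h) = x (om h').
Proof.
by move=> ac bd; congr (fmor x _); apply: val_inj; rewrite /= ac bd.
Qed.

(** Parametrising x(a, a+n) by its start and its degree avoids carrying an
    inequality between the endpoints. *)
Definition seg x a n : L := x (om (vle_addr a n)).

Lemma rng_seg x a n : rng (seg x a n) = fobj x a.
Proof. exact: functor_rng. Qed.

Lemma src_seg x a n : src (seg x a n) = fobj x (a + n).
Proof. exact: functor_src. Qed.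

Lemma deg_seg x a n : deg (seg x a n) = n.
Proof. by rewrite infpath_deg; exact: vsubDl. Qed.

Lemma segE x a b (h : vle a b) : x (om h) = seg x a (vsub b a).
Proof. by apply: path_om => //; rewrite vsubK. Qed.

Lemma comp_seg x a n e : comp (seg x a n) (seg x (a + n) e) = seg x a (n + e).
Proof.
rewrite /seg -functor_comp//; congr (fmor x _).
by apply: val_inj; rewrite val_omega_comp//= addrA.
Qed.

Lemma seg_pshift x a n m : seg (pshift m x) a n = seg x (a + m) n.
Proof. by rewrite /seg /=; apply: path_om => //=; rewrite addrAC. Qed.

Lemma seg_pshift0 x n m : seg (pshift m x) 0 n = seg x m n.
Proof. by rewrite seg_pshift add0r. Qed.

Lemma prng_pshift x m : prng (pshift m x) = fobj x m.
Proof. by rewrite /prng /= add0r. Qed.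

(** By left cancellation x(m,n) is determined by x(0,m) and x(0,n). *)
Lemma path_ext x y : (forall n, seg x 0 n = seg y 0 n) -> x = y.
Proof.
move=> H.
have O n : fobj x n = fobj y n by rewrite -{1}[n]add0r -src_seg H src_seg add0r.
apply: infpath_eq; first by apply/funext => n; exact: O.
apply/funext.
case=> -[m n] /= h; rewrite -!/(om h) !segE.
apply: (@comp_cancel (seg x 0 m)); rewrite ?src_seg ?rng_seg ?add0r//.
have := comp_seg x 0 m (vsub n m); have := comp_seg y 0 m (vsub n m).
by rewrite !add0r -!H => -> ->.
Qed.

Lemma path_split_ext n x y :
  seg x 0 n = seg y 0 n -> pshift n x = pshift n y -> x = y.
Proof.
move=> h0 hs; apply: path_ext => m.
have : seg x 0 (m + n) = seg y 0 (m + n).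
  by rewrite addrC -2!comp_seg h0 !add0r -2!(seg_pshift0 _ m n) hs.
rewrite -2!comp_seg.
by case/factor_inj; rewrite ?src_seg ?rng_seg ?deg_seg.
Qed.

Lemma seg_prefix x y n m : vle n m -> seg x 0 m = seg y 0 m ->
  seg x 0 n = seg y 0 n /\ seg x n (vsub m n) = seg y n (vsub m n).
Proof.
move=> h; rewrite -{1 2}(vsubK h) -2!comp_seg !add0r.
by case/factor_inj; rewrite ?src_seg ?rng_seg ?deg_seg ?add0r.
Qed.

(** ** Paths from coherent families of initial segments *)

Section PathOf.
Variable I : natvec k -> L.
Hypothesis degI : forall n, deg (I n) = n.
Hypothesis prefixI : forall m n, vle m n ->
  exists t, src (I m) = rng t /\ I n = comp (I m) t.

Let part (f : omega_mor k) : L :=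
  xget (I 0) [set t | src (I (omega_rng f)) = rng t /\
                      I (omega_src f) = comp (I (omega_rng f)) t].

Let partP (f : omega_mor k) : src (I (omega_rng f)) = rng (part f) /\
  I (omega_src f) = comp (I (omega_rng f)) (part f).
Proof. exact: (xgetPex (I 0) (prefixI (valP f))). Qed.

Let part_uniq (f : omega_mor k) t : src (I (omega_rng f)) = rng t ->
  I (omega_src f) = comp (I (omega_rng f)) t -> part f = t.
Proof.
move=> h E; have [h' E'] := partP f.
by apply: comp_cancel h' h _; rewrite -E'.
Qed.

Let part_rng (f : Omega k) : rng (part f) = src (I (rng f)).
Proof. by have [] := partP f. Qed.

Let part_src (f : Omega k) : src (part f) = src (I (src f)).
Proof.
have [h E] := partP f.
by rewrite -[src f]/(omega_src f) E src_comp.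
Qed.

Let part_idm (v : obj (Omega k)) : part (idm v) = idm (src (I v)).
Proof. by apply: part_uniq; rewrite /= ?rng_idm// comp_idr. Qed.

Let part_comp (f g : Omega k) : src f = rng g ->
  part (comp f g) = comp (part f) (part g).
Proof.
move=> fg; have fg' : omega_src f = omega_rng g by [].
have [hf Ef] := partP f; have [hg Eg] := partP g.
have pp : src (part f) = rng (part g) by rewrite part_src fg part_rng.
apply: part_uniq; rewrite /= ?omega_rng_comp ?omega_src_comp//.
  by rewrite rng_comp.
by rewrite Eg -fg' Ef comp_assoc.
Qed.

Let part_deg (f : Omega k) :
  deg (Functor part_rng part_src part_idm part_comp f) = deg f.
Proof.
have [h E] := partP f; apply: (@vaddI _ (omega_rng f)).
rewrite -[in RHS]omega_degK -[RHS]degI E deg_comp//.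
by rewrite degI.
Qed.

Let path_of : infpath L := InfPath part_deg.

Lemma path_of_prefixes : exists x, forall n, seg x 0 n = I n.
Proof.
exists path_of => n; rewrite /seg /=.
(* A morphism of degree zero is an identity, by unique factorisation. *)
have I0 : I 0 = idm (src (I 0)).
  have i0 : src (I 0) = rng (idm (src (I 0))) by rewrite rng_idm.
  have i1 : src (idm (rng (I 0))) = rng (I 0) by rewrite src_idm.
  have [] := factor_inj i0 i1; rewrite ?degI ?deg_idm//.
  by rewrite comp_idl comp_idr.
have [h E] := partP (om (vle_addr 0 n)).
move: h E; rewrite /omega_rng /omega_src /= => h E.
by rewrite -[in RHS](add0r n) E I0 h comp_idl.
Qed.

End PathOf.

(** The initial segments of lx are the truncations of the morphisms
    l x(0,n), which are coherent by unique factorisation. *)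
Lemma prepend_exists l x : src l = prng x ->
  exists u, seg u 0 (deg l) = l /\ pshift (deg l) u = x.
Proof.
move=> lx.
(* J n = l x(0,n) has degree d(l) + n, too large by d(l) to be the initial
   segment of lx of degree n, which is its truncation (T n).1 below. *)
pose J n := comp l (seg x 0 n).
have lJ n : src l = rng (seg x 0 n) by rewrite lx rng_seg.
have degJ n : deg (J n) = deg l + n by rewrite deg_comp// deg_seg.
have sJ n : src (J n) = fobj x n by rewrite src_comp// src_seg add0r.
have JJ n e : J (n + e) = comp (J n) (seg x n e).
  rewrite /J -comp_seg add0r comp_assoc// src_seg rng_seg add0r//.
have truncE n : exists t : L * L, [/\ deg t.1 = n, src t.1 = rng t.2 &
    J n = comp t.1 t.2].
  have [t [[t1 t2 t3 t4] _]] := factorisation (etrans (degJ n) (addrC _ _)).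
  by exists t.
have [T TP] := choice truncE.
have [||u uE] := @path_of_prefixes (fun n => (T n).1).
- by move=> n; case: (TP n).
- move=> m n mn.
  have [dm cm Em] := TP m; have [dn cn En] := TP n.
  have [dmn tmn] : exists p : L * L, [/\ deg p.1 = m, src p.1 = rng p.2 &
      (T n).1 = comp p.1 p.2].
    have dd : deg (T n).1 = m + vsub n m by rewrite dn vsubK.
    by have [p [[p1 p2 p3 p4] _]] := factorisation dd; exists p.
  case: tmn => p1 p2 p3; exists dmn.2.
  have s2 : src dmn.2 = rng (T n).2 by rewrite -cn p3 src_comp.
  have q1 : src (T m).2 = rng (seg x m (vsub n m)).
    by rewrite rng_seg -sJ Em src_comp.
  have E : comp (T m).1 (comp (T m).2 (seg x m (vsub n m))) =
           comp dmn.1 (comp dmn.2 (T n).2).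
    by rewrite -!comp_assoc// -p3 -En -Em -JJ vsubK.
  case: (factor_inj _ _ _ E); rewrite ?rng_comp ?dm ?p1//.
  by move=> -> _.
have pre n : seg u 0 (n + deg l) = J n.
  rewrite uE; have [dn cn En] := TP (n + deg l).
  have [] := @factor_inj (T (n + deg l)).1 (T (n + deg l)).2
    (J n) (seg x n (deg l)) => //.
  - by rewrite sJ rng_seg.
  - by rewrite dn degJ addrC.
  - by rewrite -En -JJ.
have J0 : J 0 = l.
  have dd : deg (J 0) = deg l by rewrite degJ addr0.
  have [] := @factor_inj (J 0) (idm (src (J 0))) l (seg x 0 0) => //.
    by rewrite rng_idm.
  by rewrite comp_idr.
have ul : seg u 0 (deg l) = l by rewrite -[deg l]add0r pre.
exists u; split=> //; apply: path_ext => n.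
rewrite seg_pshift0; apply: (@comp_cancel l) => //.
  by rewrite -{1}ul src_seg rng_seg add0r.
have := comp_seg u 0 (deg l) n; rewrite ul add0r => ->.
by rewrite addrC pre.
Qed.

Lemma prependP l x : src l = prng x ->
  seg (prepend l x) 0 (deg l) = l /\ pshift (deg l) (prepend l x) = x.
Proof.
move=> /prepend_exists[u [u1 u2]].
have om0 (z : infpath L) : z (om (vle0 (deg l))) = seg z 0 (deg l).
  by apply: path_om; rewrite ?add0r.
rewrite -om0.
apply: (@xgetPex _ x [set v : infpath L |
  v (om (vle0 (deg l))) = l /\ pshift (deg l) v = x]).
by exists u; rewrite /= om0.
Qed.

Lemma prepend_uniq u l x :
  seg u 0 (deg l) = l -> pshift (deg l) u = x -> u = prepend l x.
Proof.
move=> ul ux.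
have lx : src l = prng x by rewrite -ux prng_pshift -{1}ul src_seg add0r.
have [pl px] := prependP lx.
by apply: (@path_split_ext (deg l)); rewrite ?ul ?ux.
Qed.

End Segments.

(** * Levels of groupoid elements *)

Section Levels.
Variables (k : nat) (L : kgraph k).
Implicit Types (g h : pgroupoid L) (a b m n e N M R E : natvec k) (p : L * L).

Lemma gcomposableP g h : gcomposable (g, h) <-> glst g = gfst h.
Proof.
split=> [/(congr1 (@gfst _ _))//|e].
by rewrite /gcomposable /= /gsrc /grng e.
Qed.

Lemma gval_mul g h : glst g = gfst h ->
  gval (gmul g h) = (gfst g, gdeg g + gdeg h, glst h).
Proof. by move=> gh; rewrite /gmul val_insubd gmul_subproof. Qed.

Lemma gfst_mul g h : glst g = gfst h -> gfst (gmul g h) = gfst g.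
Proof. by move=> gh; rewrite /gfst gval_mul. Qed.

Lemma glst_mul g h : glst g = gfst h -> glst (gmul g h) = glst h.
Proof. by move=> gh; rewrite /glst gval_mul. Qed.

Lemma gdeg_mul g h : glst g = gfst h -> gdeg (gmul g h) = gdeg g + gdeg h.
Proof. by move=> gh; rewrite /gdeg gval_mul. Qed.

Lemma pgroupoid_eq g h : gfst g = gfst h -> gdeg g = gdeg h ->
  glst g = glst h -> g = h.
Proof.
rewrite /gfst /gdeg /glst => e1 e2 e3; apply: val_inj => /=.
by case: (gval g) (gval h) e1 e2 e3 => -[x n] y [[x' n'] y'] /= -> -> ->.
Qed.

Lemma gmulA g1 g2 g3 : glst g1 = gfst g2 -> glst g2 = gfst g3 ->
  gmul (gmul g1 g2) g3 = gmul g1 (gmul g2 g3).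
Proof.
move=> h12 h23; have h123 : glst (gmul g1 g2) = gfst g3 by rewrite glst_mul.
have h123' : glst g1 = gfst (gmul g2 g3) by rewrite gfst_mul.
apply: pgroupoid_eq; first by rewrite !gfst_mul.
  by rewrite !gdeg_mul// addrA.
by rewrite !glst_mul.
Qed.

Lemma gmul1g x h : x = gfst h -> gmul (gunit x) h = h.
Proof.
move=> xh; apply: pgroupoid_eq; rewrite ?gfst_mul ?glst_mul ?gdeg_mul//.
by rewrite [gdeg (gunit x)]/gdeg /= add0r.
Qed.

Lemma gmulg1 g x : glst g = x -> gmul g (gunit x) = g.
Proof.
move=> xh; apply: pgroupoid_eq; rewrite ?gfst_mul ?glst_mul ?gdeg_mul//.
by rewrite [gdeg (gunit x)]/gdeg /= addr0.
Qed.

(** A pair (N, M) is a level of (x, n, y) when it witnesses membership in the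
    groupoid.  The cylinders containing g then correspond to the levels of g,
    with the two morphisms being x(0,N) and y(0,M); and the data alpha, beta,
    gamma in the definition of the cocycle amount to compatible levels of g,
    h and gh. *)
Definition level g N M : Prop :=
  gdeg g = vint N - vint M /\ pshift N (gfst g) = pshift M (glst g).

Lemma level_exists g : exists N M, level g N M.
Proof. by have := gvalP g; rewrite inE. Qed.

Lemma levelD g N M e : level g N M -> level g (N + e) (M + e).
Proof.
move=> [dE sE]; split.
  by rewrite dE; apply/vint_subE; rewrite addrA addrAC.
by rewrite ![_ + e]addrC -!pshiftD sE.
Qed.

Lemma level_diag g N M N' M' : level g N M -> level g N' M' ->
  N + M' = N' + M.
Proof. by move=> [d _] [d' _]; apply/vint_subE; rewrite -d. Qed.

Lemma level_mul g h N M R : glst g = gfst h ->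
  level g N M -> level h M R -> level (gmul g h) N R.
Proof.
move=> gh [dg sg] [dh sh]; rewrite /level gdeg_mul// gfst_mul// glst_mul//.
by split; rewrite ?sg ?gh// dg dh addrA subrK.
Qed.

Lemma level_sub g a b N M : level g a b -> level g N M -> vle a N ->
  vle b M /\ vsub M b = vsub N a.
Proof.
move=> lab lNM aN.
have -> : M = b + vsub N a.
  apply: (@vaddI _ a); rewrite (level_diag lab lNM) addrCA vsubK//.
  by rewrite addrC.
by rewrite vle_addr vsubDl.
Qed.

Lemma level_tail g a b n : level g a b -> seg (gfst g) a n = seg (glst g) b n.
Proof. by move=> [_ s]; rewrite -seg_pshift0 s seg_pshift0. Qed.

Lemma level_src g a b : level g a b ->
  src (seg (gfst g) 0 a) = src (seg (glst g) 0 b).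
Proof. by move=> [_ s]; rewrite !src_seg !add0r -2!prng_pshift s. Qed.

Lemma level_unit x N M : level (gunit x) N M -> N = M.
Proof.
by move=> [/esym /eqP d _]; move: d; rewrite subr_eq0 => /eqP /vint_inj.
Qed.

(** Raising levels is always possible, so that finitely many lower bounds can
    be met simultaneously along composable elements. *)
Lemma level_chain2 (s : seq (natvec k)) g h : glst g = gfst h ->
  exists N M R, (level g N M /\ level h M R) /\
    [/\ {in s, forall m, vle m N}, {in s, forall m, vle m M} &
        {in s, forall m, vle m R}].
Proof.
move=> gh; have [a [b lg]] := level_exists g.
have [b' [r lh]] := level_exists h.
pose E := \sum_(m <- s) m.
exists (a + b' + E), (b + b' + E), (r + b + E); split.
  split; apply: levelD; first exact: levelD.
  by rewrite [b + b']addrC; apply: levelD.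
by split=> m ms; apply: vle_trans (vle_sum ms) (vle_addl _ _).
Qed.

Lemma level_chain3 (s : seq (natvec k)) g1 g2 g3 :
  glst g1 = gfst g2 -> glst g2 = gfst g3 ->
  exists N0 N1 N2 N3, [/\ level g1 N0 N1, level g2 N1 N2 & level g3 N2 N3] /\
    [/\ {in s, forall m, vle m N0}, {in s, forall m, vle m N1} &
        {in s, forall m, vle m N2}].
Proof.
move=> h12 h23; have [N [M [R [[l1 l2] [B0 B1 B2]]]]] := level_chain2 s h12.
have [r [t l3]] := level_exists g3.
exists (N + r), (M + r), (R + r), (t + R); split.
  by split; [exact: levelD|exact: levelD|rewrite addrC; exact: levelD].
by split=> m ms; apply: vle_add2; [exact: B0|exact: B1|exact: B2].
Qed.

(** ** Cylinders *)

Lemma cylP p g : src p.1 = src p.2 ->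
  cyl p g <-> [/\ seg (gfst g) 0 (deg p.1) = p.1,
                  seg (glst g) 0 (deg p.2) = p.2 & level g (deg p.1) (deg p.2)].
Proof.
move=> pp; split=> [[x [xp gE]]|[s1 s2 [dE sE]]].
  have [u1 u2] := prependP (esym xp).
  have [v1 v2] := prependP (etrans (esym pp) (esym xp)).
  by rewrite /level /gfst /glst /gdeg gE /= u1 v1 u2 v2.
exists (pshift (deg p.1) (gfst g)); split.
  by rewrite prng_pshift -{2}s1 src_seg add0r.
rewrite -(prepend_uniq s1 erefl) sE -(prepend_uniq s2 erefl) -dE.
by rewrite /gfst /gdeg /glst; case: (gval g) => -[].
Qed.

Definition level_cyl g N M : set (pgroupoid L) :=
  cyl (seg (gfst g) 0 N, seg (glst g) 0 M).

Lemma level_cylP g N M h : level g N M ->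
  level_cyl g N M h <-> [/\ seg (gfst h) 0 N = seg (gfst g) 0 N,
    seg (glst h) 0 M = seg (glst g) 0 M & level h N M].
Proof.
move=> lg; rewrite /level_cyl.
have := @cylP (seg (gfst g) 0 N, seg (glst g) 0 M) h (level_src lg).
by rewrite /= !deg_seg.
Qed.

Lemma level_cyl_self g N M : level g N M -> level_cyl g N M g.
Proof. by move=> lg; apply/level_cylP. Qed.

Lemma level_cyl_nbhs g N M : level g N M -> nbhs g (level_cyl g N M).
Proof.
move=> lg; apply: open_nbhs_nbhs; split; last exact: level_cyl_self.
exists [set level_cyl g N M]; last by rewrite bigcup_set1.
move=> _ ->; apply: (@finI_from1 _ _ _ id).
by exists (seg (gfst g) 0 N, seg (glst g) 0 M); [exact: level_src|].
Qed.

(** Membership in a cylinder at (N, M) fixes the segments up to N and M, hence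
    those up to d(p.1) and d(p.2), and makes the remaining tails agree from
    d(p.1) and d(p.2) on. *)
Lemma level_cylS g p N M : src p.1 = src p.2 -> cyl p g ->
  level g N M -> vle (deg p.1) N -> level_cyl g N M `<=` cyl p.
Proof.
move=> pp /(cylP _ pp)[s1 s2 lp] lN aN h /(level_cylP _ lN)[t1 t2 lh].
have [bM E] := level_sub lp lN aN.
have [i1 j1] := seg_prefix aN t1; have [i2 j2] := seg_prefix bM t2.
apply/(cylP _ pp); split; [by rewrite i1|by rewrite i2|split].
  by rewrite lh.1 -lN.1 lp.1.
apply: (@path_split_ext _ _ (vsub N (deg p.1))).
  by rewrite !seg_pshift0 j1 -E j2 E; apply: level_tail.
rewrite !pshiftD -{2}E ![vsub _ _ + _]addrC !vsubK//.
exact: lh.2.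
Qed.

Lemma gextendsP g p (a : L) (y : infpath L) :
  src p.1 = src p.2 -> rng a = src p.1 -> prng y = src a ->
  gextends g p a y <->
  [/\ cyl p g, seg (gfst g) (deg p.1) (deg a) = a &
      y = pshift (deg p.1 + deg a) (gfst g)].
Proof.
move=> pp ap ya; have ap2 : src p.2 = rng a by rewrite ap.
have s1 : src (comp p.1 a) = prng y by rewrite src_comp.
have s2 : src (comp p.2 a) = prng y by rewrite src_comp.
have [u1 u2] := prependP s1; have [v1 v2] := prependP s2.
move: u1 u2 v1 v2; rewrite !deg_comp// => u1 u2 v1 v2.
rewrite /gextends; split=> [gE|[/(cylP _ pp)[t1 t2 lp] aE yE]].
  have xE : gfst g = prepend (comp p.1 a) y by rewrite /gfst gE.
  have zE : glst g = prepend (comp p.2 a) y by rewrite /glst gE.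
  have dE : gdeg g = vint (deg p.1) - vint (deg p.2) by rewrite /gdeg gE.
  rewrite -xE in u1 u2; rewrite -zE in v1 v2.
  have split_at l z : src l = rng a ->
      seg z 0 (deg l + deg a) = comp l a ->
      seg z 0 (deg l) = l /\ seg z (deg l) (deg a) = a.
    move=> la; rewrite -comp_seg add0r.
    by case/factor_inj; rewrite ?src_seg ?rng_seg ?deg_seg ?add0r.
  have [w1 w2] := split_at _ _ (esym ap) u1.
  have [w3 w4] := split_at _ _ ap2 v1.
  split=> //; apply/(cylP _ pp); split=> //; split=> //.
  apply: (@path_split_ext _ _ (deg a)).
    by rewrite !seg_pshift0 w2 w4.
  by rewrite !pshiftD ![deg a + _]addrC u2 v2.
have xE : gfst g = prepend (comp p.1 a) y.
  apply: prepend_uniq; rewrite deg_comp//.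
  by rewrite -comp_seg add0r t1 aE.
have zE : glst g = prepend (comp p.2 a) y.
  apply: prepend_uniq; rewrite deg_comp//.
    by rewrite -comp_seg add0r t2 -(level_tail _ lp) aE.
  by rewrite yE (levelD _ lp).2.
rewrite -xE -zE -lp.1.
by rewrite /gfst /gdeg /glst; case: (gval g) => -[].
Qed.

End Levels.

(** * The cocycle in terms of levels *)

Lemma add_telescope (A : zmodType) (a b d x y z : A) :
  (a + (x - y)) + (b + (y - z)) - (d + (x - z)) = a + b - d.
Proof.
have E : (x - y) + (y - z) = x - z by rewrite addrA subrK.
by rewrite addrACA E opprD addrACA subrr addr0.
Qed.

Lemma sub_combine (A : zmodType) (a b d a' b' d' : A) :
  (a + b - d) - (a' + b' - d') = (a - a') - (d - d') + (b - b').
Proof. by rewrite !opprD !opprK !addrA [LHS](ACl (1*4*3*6*2*5)). Qed.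

Lemma add_cocycle (A : zmodType) (a b d e f g : A) :
  (a + b - e) + (e + d - g) = (b + d - f) + (a + f - g).
Proof.
have -> : (a + b - e) + (e + d - g) = a + b + d - g by rewrite !addrA subrK.
by rewrite [a + f]addrC !addrA subrK [b + d + a]addrC !addrA.
Qed.

Section Kappa.
Variables (k : nat) (L : kgraph k) (A : zmodType).
Implicit Types (g h : pgroupoid L) (x : infpath L) (P : set (L * L)).
Implicit Types (a b e N M R : natvec k) (p : L * L) (c : L * L -> A).

Lemma pindexP P g : cyl_partition P -> P (pindex P g) /\ cyl (pindex P g) g.
Proof.
move=> [_ [PT _ _]]; have : [set: pgroupoid L] g by [].
rewrite -PT => -[p Pp gp].
by apply: (@xgetPex _ _ [set q | P q /\ cyl q g]); exists p.
Qed.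

Lemma pindex_src P g : cyl_partition P ->
  src (pindex P g).1 = src (pindex P g).2.
Proof. by move=> PP; case: (pindexP g PP) => /(PP.1). Qed.

Lemma pindex_uniq P g p : cyl_partition P -> P p -> cyl p g -> pindex P g = p.
Proof.
move=> PP Pp gp; have [Pi gi] := pindexP g PP; case: PP => _ [_ tI _].
by apply: tI => //; exists g.
Qed.

Lemma pindex_level P g : cyl_partition P ->
  level g (deg (pindex P g).1) (deg (pindex P g).2).
Proof.
by move=> PP; have [_ /(cylP _ (pindex_src g PP))[]] := pindexP g PP.
Qed.

(** At the levels not below (d(mu_g), d(nu_g)) the morphism alpha exists; a
    bound on N suffices, as N - M is determined by g. *)
Definition admissible P g N M : Prop :=
  level g N M /\ vle (deg (pindex P g).1) N.

Definition segval c x a N : A := c (seg x 0 a, seg x a (vsub N a)).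

(** The contribution c(mu_g, alpha) - c(nu_g, alpha) of g to the cocycle, read
    off at the level that alpha reaches. *)
Definition kappa P c g N M : A :=
  segval c (gfst g) (deg (pindex P g).1) N
  - segval c (glst g) (deg (pindex P g).2) M.

(** The term D_x(N) by which lengthening x(0,N) by e changes [segval]. *)
Definition lengthen c x N e : A := c (seg x 0 N, seg x N e).

(** The cocycle identity for the triple x(0,a), x(a,N), x(N,N+e). *)
Lemma segvalD c x a N e : catZ2 c -> vle a N ->
  segval c x a (N + e) =
  segval c x a N + lengthen c x N e - c (seg x a (vsub N a), seg x N e).
Proof.
move=> [_ cZ] aN; apply/eqP; rewrite eq_sym subr_eq; apply/eqP.
have h1 : src (seg x 0 a) = rng (seg x a (vsub N a)).
  by rewrite src_seg rng_seg add0r.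
have h2 : src (seg x a (vsub N a)) = rng (seg x N e).
  by rewrite src_seg rng_seg vsubK.
have E1 : comp (seg x 0 a) (seg x a (vsub N a)) = seg x 0 N.
  by have := comp_seg x 0 a (vsub N a); rewrite add0r vsubK.
have E2 : comp (seg x a (vsub N a)) (seg x N e) = seg x a (vsub (N + e) a).
  by have := comp_seg x a (vsub N a) e; rewrite vsubK// vsubDr.
by have := cZ _ _ _ h1 h2; rewrite E1 E2 addrC [RHS]addrC => ->; rewrite addrC.
Qed.

(** Raising the level changes kappa by a difference of a term depending only
    on the path r(g) and one depending only on the path s(g): by the cocycle
    identity, what is left over involves only the common tail of the two
    paths. *)
Lemma kappaD P c g N M e : cyl_partition P -> catZ2 c -> admissible P g N M ->
  kappa P c g (N + e) (M + e) =
  kappa P c g N M + (lengthen c (gfst g) N e - lengthen c (glst g) M e).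
Proof.
move=> PP cZ [lN aN]; have lp := pindex_level g PP.
have [bM E] := level_sub lp lN aN.
rewrite /kappa !segvalD// E -(level_tail _ lp) -(level_tail _ lN).
by rewrite opprB addrA subrK opprD addrACA.
Qed.

Definition kappa3 P c g h N M R : A :=
  kappa P c g N M + kappa P c h M R - kappa P c (gmul g h) N R.

Definition admissible3 P g h N M R : Prop :=
  [/\ admissible P g N M, admissible P h M R & admissible P (gmul g h) N R].

(** Along a composable pair the changes in kappa cancel, and any two levels
    have a common raising. *)
Lemma kappa3_indep P c g h N M R N' M' R' :
  cyl_partition P -> catZ2 c -> glst g = gfst h ->
  admissible3 P g h N M R -> admissible3 P g h N' M' R' ->
  kappa3 P c g h N M R = kappa3 P c g h N' M' R'.
Proof.
move=> PP cZ gh.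
have raise N1 M1 R1 e : admissible3 P g h N1 M1 R1 ->
    kappa3 P c g h (N1 + e) (M1 + e) (R1 + e) = kappa3 P c g h N1 M1 R1.
  move=> [a1 a2 a3]; rewrite /kappa3 !kappaD// gfst_mul// glst_mul// gh.
  exact: add_telescope.
move=> a a'; rewrite -(raise _ _ _ N' a) -(raise _ _ _ N a').
have [[l1 _] [l2 _] [l3 _]] := a; have [[l1' _] [l2' _] [l3' _]] := a'.
have := level_diag l1 l1'; have := level_diag l3 l3'.
rewrite [N + R']addrC [N' + R]addrC [N + M']addrC [N' + M]addrC => -> ->.
by rewrite [N' + N]addrC.
Qed.

(** This lemma and the next pass between levels and the morphisms alpha of the
    definition of the cocycle: alpha is the segment of r(g) from d(mu_g) to the
    level, and the level is the pair (d(mu_g) + d(alpha), d(nu_g) + d(alpha)). *)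
Lemma admissible_gextends P c g N M : cyl_partition P -> admissible P g N M ->
  let p := pindex P g in
  let al := seg (gfst g) (deg p.1) (vsub N (deg p.1)) in
  [/\ rng al = src p.1, prng (pshift N (gfst g)) = src al,
      comp p.1 al = seg (gfst g) 0 N /\ comp p.2 al = seg (glst g) 0 M,
      gextends g p al (pshift N (gfst g)) &
      c (p.1, al) - c (p.2, al) = kappa P c g N M].
Proof.
move=> PP [lN aN] p al.
have pp : src p.1 = src p.2 := pindex_src g PP.
have gp : cyl p g := (pindexP g PP).2.
have [s1 s2 lp] := (cylP g pp).1 gp.
have [bM E] := level_sub lp lN aN.
have al2 : al = seg (glst g) (deg p.2) (vsub M (deg p.2)).
  by rewrite E -(level_tail _ lp).
have ap : rng al = src p.1 by rewrite rng_seg -{2}s1 src_seg add0r.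
have ay : prng (pshift N (gfst g)) = src al.
  by rewrite prng_pshift src_seg vsubK.
split=> //.
- split.
    have := comp_seg (gfst g) 0 (deg p.1) (vsub N (deg p.1)).
    by rewrite s1 add0r vsubK.
  have := comp_seg (glst g) 0 (deg p.2) (vsub M (deg p.2)).
  by rewrite s2 add0r vsubK// -al2.
- apply/(gextendsP _ pp ap ay); split=> //; first by rewrite deg_seg.
  by rewrite deg_seg vsubK.
- by rewrite /kappa /segval -/p s1 s2 -al2.
Qed.

Lemma gextends_admissible P c g (al : L) y : cyl_partition P ->
  let p := pindex P g in
  rng al = src p.1 -> prng y = src al -> gextends g p al y ->
  admissible P g (deg p.1 + deg al) (deg p.2 + deg al) /\
  kappa P c g (deg p.1 + deg al) (deg p.2 + deg al) =
  c (p.1, al) - c (p.2, al).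
Proof.
move=> PP p ap ay; have pp : src p.1 = src p.2 := pindex_src g PP.
move=> /(gextendsP _ pp ap ay)[gp sE _].
have [s1 s2 lp] := (cylP g pp).1 gp.
split; first by split; [exact: levelD|exact: vle_addr].
by rewrite /kappa /segval -/p s1 s2 !vsubDl -(level_tail _ lp) sE.
Qed.

(** The equations between mu_g alpha, nu_h beta and the like say, after taking
    degrees, that the levels reached by alpha, beta and gamma fit together as
    levels of g, h and gh. *)
Lemma sigma_cE P c g h N M R : cyl_partition P -> catZ2 c ->
  glst g = gfst h -> admissible3 P g h N M R ->
  sigma_c P c (g, h) = kappa3 P c g h N M R.
Proof.
move=> PP cZ gh adm; rewrite /sigma_c /=.
set S := [set v | _].
have S_val v : S v -> v = kappa3 P c g h N M R.
  move=> [_ [al [be [ga [y]]]]].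
  move=> [[r1 r2 r3] [yal albe bega] [E1 E2 E3] [x1 x2 x3] ->].
  have [a1 <-] := gextends_admissible c PP r1 yal x1.
  have [a2 <-] := gextends_admissible c PP r2 (etrans yal albe) x2.
  have [a3 <-] :=
    gextends_admissible c PP r3 (etrans yal (etrans albe bega)) x3.
  have ps := pindex_src g PP; have qs := pindex_src h PP.
  have ws := pindex_src (gmul g h) PP.
  have D1 := congr1 (@deg _ L) E1; have D2 := congr1 (@deg _ L) E2.
  have D3 := congr1 (@deg _ L) E3.
  rewrite !deg_comp -?ps -?qs -?ws // in D1 D2 D3.
  rewrite D2 -D3 -D1 in a2 a3 *.
  exact: kappa3_indep adm.
suff Sex : exists v, S v by exact: S_val (xgetPex 0 Sex).
exists (kappa3 P c g h N M R).
have [ad1 ad2 ad3] := adm.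
have /=[r1 y1 [m1 n1] x1 v1] := admissible_gextends c PP ad1.
have /=[r2 y2 [m2 n2] x2 v2] := admissible_gextends c PP ad2.
have /=[r3 y3 [m3 n3] x3 v3] := admissible_gextends c PP ad3.
have tg : pshift M (gfst h) = pshift N (gfst g) by rewrite ad1.1.2 gh.
have tw : pshift N (gfst (gmul g h)) = pshift N (gfst g) by rewrite gfst_mul.
split; first exact/gcomposableP.
do 3 eexists; exists (pshift N (gfst g)); split.
- by split; [exact: r1|exact: r2|exact: r3].
- by split=> //; rewrite -?y1 -?y2 -?y3 ?tg ?tw.
- split; first by rewrite m1 m3 gfst_mul.
    by rewrite n2 n3 glst_mul.
  by rewrite n1 m2 gh.
- by rewrite tg in x2; rewrite tw in x3; split.
- by rewrite v1 v2 v3.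
Qed.

Lemma sigma_c_eq0 P c g h : ~ gcomposable (g, h) -> sigma_c P c (g, h) = 0.
Proof. by move=> ngh; rewrite /sigma_c xgetPN// => v [] /ngh. Qed.

Lemma admissible3_exists P P' g h : glst g = gfst h ->
  exists N M R, admissible3 P g h N M R /\ admissible3 P' g h N M R.
Proof.
move=> gh; pose d Q f := deg (@pindex _ L Q f).1.
have [N [M [R [[l1 l2] [BN BM _]]]]] := level_chain2 [:: d P g; d P h;
  d P (gmul g h); d P' g; d P' h; d P' (gmul g h)] gh.
have l3 := level_mul gh l1 l2.
exists N, M, R; split; split; split=> //; (apply: BN || apply: BM);
  by rewrite !inE eqxx ?orbT.
Qed.

Lemma kappa_unit P c x N M : cyl_partition P -> level (gunit x) N M ->
  kappa P c (gunit x) N M = 0.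
Proof.
move=> PP /level_unit ->; have /level_unit E := pindex_level (gunit x) PP.
by rewrite /kappa E subrr.
Qed.

End Kappa.

(** Levels N0, ..., N3 at which all four values of sigma_c in the cocycle
    identity can be evaluated. *)
Lemma admissible_chain3 k (L : kgraph k) (P : set (L * L))
    (g1 g2 g3 : pgroupoid L) :
  glst g1 = gfst g2 -> glst g2 = gfst g3 ->
  exists N0 N1 N2 N3,
    [/\ admissible3 P g1 g2 N0 N1 N2,
        admissible3 P (gmul g1 g2) g3 N0 N2 N3,
        admissible3 P g2 g3 N1 N2 N3 &
        admissible3 P g1 (gmul g2 g3) N0 N1 N3].
Proof.
move=> h12 h23; pose d f := deg (@pindex _ L P f).1.
have [N0 [N1 [N2 [N3 [[l1 l2 l3] [B0 B1 B2]]]]]] := level_chain3 [:: d g1;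
  d g2; d g3; d (gmul g1 g2); d (gmul g2 g3); d (gmul (gmul g1 g2) g3)] h12 h23.
have l12 := level_mul h12 l1 l2; have l23 := level_mul h23 l2 l3.
have l123 : level (gmul (gmul g1 g2) g3) N0 N3.
  by apply: level_mul l12 l3; rewrite glst_mul.
exists N0, N1, N2, N3; split; rewrite /admissible3 -?gmulA//;
  split; split=> //; (apply: B0 || apply: B1 || apply: B2);
  by rewrite !inE eqxx ?orbT.
Qed.

(** * Local constancy *)

Lemma locally_constant_within (S T : topologicalType) (D : set S) (f : S -> T) :
  (forall x, D x -> exists2 U, nbhs x U & forall y, U y -> D y -> f y = f x) ->
  {within D, continuous f}.
Proof.
move=> H; apply/subspace_continuousP => x Dx V fxV.
have [U xU Uf] := H x Dx; apply: filterS xU => y Uy Dy.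
by suff: V (f y) by []; rewrite (Uf y Uy Dy); exact: nbhs_singleton.
Qed.

Lemma locally_constant_continuous (S T : topologicalType) (f : S -> T) :
  (forall x, exists2 U, nbhs x U & forall y, U y -> f y = f x) -> continuous f.
Proof.
move=> H x V fxV; have [U xU Uf] := H x; apply: filterS xU => y Uy.
by suff: V (f y) by []; rewrite (Uf y Uy); exact: nbhs_singleton.
Qed.

(** A cylinder at an admissible level of g lies in the member of the partition
    containing g, and its elements share with g the segments that kappa
    depends on. *)
Lemma kappa_local k (L : kgraph k) (A : zmodType) (P : set (L * L))
    (c : L * L -> A) (g g' : pgroupoid L) (N M : natvec k) :
  cyl_partition P -> admissible P g N M -> level_cyl g N M g' ->
  [/\ pindex P g' = pindex P g, admissible P g' N M &
      kappa P c g' N M = kappa P c g N M].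
Proof.
move=> PP [lN aN] g'N.
have [Pp gp] := pindexP g PP; have pp := pindex_src g PP.
have E : pindex P g' = pindex P g.
  by apply: pindex_uniq => //; exact: (level_cylS pp gp lN aN).
have [t1 t2 l'] := (level_cylP _ lN).1 g'N.
have [bM _] := level_sub (pindex_level g PP) lN aN.
split=> //; first by split; rewrite ?E.
rewrite /kappa /segval E.
have [-> ->] := seg_prefix aN t1; by have [-> ->] := seg_prefix bM t2.
Qed.

Section GroupoidCocycle.
Variables (k : nat) (L : kgraph k) (A : topologicalZmodType).
Implicit Types (g h : pgroupoid L) (P : set (L * L)) (c : catcocycle2 L A).

Lemma catcocycle2_Z2 c : catZ2 c.
Proof. by have := catcocycle2P c; rewrite unfold_in inE. Qed.

Lemma gpdcocycle2_Z2 (s : gpdcocycle2 L A) : gpdZ2 s.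
Proof. by have := gpdcocycle2P s; rewrite unfold_in inE. Qed.

Lemma sigma_c_continuous P (c : L * L -> A) : cyl_partition P -> catZ2 c ->
  {within @gcomposable k L, continuous (sigma_c P c)}.
Proof.
move=> PP cZ; apply: locally_constant_within => -[g h] /gcomposableP gh.
have [N [M [R [adm _]]]] := admissible3_exists P P gh.
have [a1 a2 a3] := adm.
exists (level_cyl g N M `*` level_cyl h M R).
  by exists (level_cyl g N M, level_cyl h M R) => //=; split=> /=;
    apply: level_cyl_nbhs; [exact: a1.1|exact: a2.1].
move=> [g' h'] [/= g'U h'U] /gcomposableP gh'.
have [_ b1 e1] := kappa_local c PP a1 g'U.
have [_ b2 e2] := kappa_local c PP a2 h'U.
have [s1 s2 l1] := (level_cylP _ a1.1).1 g'U.
have [t1 t2 l2] := (level_cylP _ a2.1).1 h'U.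
have w'U : level_cyl (gmul g h) N R (gmul g' h').
  apply/(level_cylP _ a3.1).
  by rewrite !gfst_mul// !glst_mul//; split=> //; exact: level_mul l1 l2.
have [_ b3 e3] := kappa_local c PP a3 w'U.
rewrite (sigma_cE PP cZ gh adm) (sigma_cE PP cZ gh' (And3 b1 b2 b3)).
by rewrite /kappa3 e1 e2 e3.
Qed.

Lemma sigma_c_Z2 P c : cyl_partition P -> gpdZ2 (sigma_c P c).
Proof.
move=> PP; have cZ := catcocycle2_Z2 c; split; first split.
- exact: sigma_c_continuous.
- by move=> g h; exact: sigma_c_eq0.
- move=> g h /gcomposableP gh u.
  have [N [M [R [adm _]]]] := admissible3_exists P P gh.
  rewrite (sigma_cE PP cZ gh adm) /kappa3; have [a1 a2 a3] := adm.
  case: u gh adm a1 a2 a3 => -[x ->] gh adm a1 a2 a3.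
    rewrite (kappa_unit _ PP a1.1) gmul1g// (level_unit a1.1) add0r subrr//.
  by rewrite (kappa_unit _ PP a2.1) gmulg1// (level_unit a2.1) addr0 subrr.
- move=> g1 g2 g3 /gcomposableP h12 /gcomposableP h23.
  have [N0 [N1 [N2 [N3 [a1 a2 a3 a4]]]]] := admissible_chain3 P h12 h23.
  rewrite (sigma_cE PP cZ h12 a1) (sigma_cE PP cZ h23 a3).
  rewrite (sigma_cE PP cZ (etrans (glst_mul h12) h23) a2).
  rewrite (sigma_cE PP cZ (etrans h12 (esym (gfst_mul h23))) a4).
  by rewrite /kappa3 gmulA//; exact: add_cocycle.
Qed.

(** * Comparison of cohomology classes *)

(** Off the composable pairs both cocycles vanish, so their difference need
    only be a coboundary on composable pairs. *)
Lemma gpdclass_eq (s s' : gpdcocycle2 L A) (a : pgroupoid L -> A) : gpdC1 a ->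
  (forall g h, glst g = gfst h ->
    s (g, h) - s' (g, h) = a g - a (gmul g h) + a h) ->
  gpdclass s = gpdclass s'.
Proof.
move=> aC E; apply/eqP; rewrite -Quotient.idealrBE unfold_in inE.
exists a => //; apply/funext => -[g h]; rewrite /gpdd1 /=.
rewrite -[RHS]/(s (g, h) - s' (g, h)).
case: asboolP => [/gcomposableP gh|ngh]; first by rewrite E.
have [[_ s0 _] _] := gpdcocycle2_Z2 s; have [[_ s0' _] _] := gpdcocycle2_Z2 s'.
by rewrite s0// s0'// subrr.
Qed.

(** The cochain comparing two partitions is the difference of the two
    functions kappa: by [kappaD] it depends on the groupoid element only. *)
Lemma gpdclass_partition P P' c (s s' : gpdcocycle2 L A) :
  cyl_partition P -> cyl_partition P' ->
  s = sigma_c P c :> (_ -> _) -> s' = sigma_c P' c :> (_ -> _) ->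
  gpdclass s = gpdclass s'.
Proof.
move=> PP PP' sE sE'; have cZ := catcocycle2_Z2 c.
pose D g N M := kappa P c g N M - kappa P' c g N M.
have D_raise g N M e : admissible P g N M -> admissible P' g N M ->
    D g (N + e) (M + e) = D g N M.
  move=> a a'; rewrite /D !kappaD// opprD addrACA subrr addr0//.
have D_indep g N M N' M' :
    admissible P g N M -> admissible P' g N M ->
    admissible P g N' M' -> admissible P' g N' M' -> D g N M = D g N' M'.
  move=> a1 a2 b1 b2; rewrite -(D_raise g N M N')// -(D_raise g N' M' N)//.
  by rewrite [M' + N]addrC (level_diag a1.1 b1.1) [N + N']addrC [N' + M]addrC.
pose N g := deg (pindex P g).1 + deg (pindex P' g).1.
pose M g := deg (pindex P g).2 + deg (pindex P' g).1.
have adN g : admissible P g (N g) (M g) /\ admissible P' g (N g) (M g).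
  have l : level g (N g) (M g) by apply: levelD; exact: pindex_level.
  by split; split=> //; [exact: vle_addr|exact: vle_addl].
pose a g := D g (N g) (M g).
have aE g n m : admissible P g n m -> admissible P' g n m -> D g n m = a g.
  by move=> a1 a2; have [b1 b2] := adN g; exact: D_indep.
apply: (@gpdclass_eq _ _ a).
  split.
    apply: locally_constant_continuous => g; have [b1 b2] := adN g.
    exists (level_cyl g (N g) (M g)); first exact: level_cyl_nbhs b1.1.
    move=> g' g'U; have [_ c1 e1] := kappa_local c PP b1 g'U.
    have [_ c2 e2] := kappa_local c PP' b2 g'U.
    by rewrite -(aE g' _ _ c1 c2) /a /D e1 e2.
  move=> _ [x ->]; have [[b1 _] _] := adN (gunit x).
  by rewrite /a /D !(kappa_unit _ _ b1)// subrr.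
move=> g h gh; rewrite sE sE'.
have [n [m [r [ad ad']]]] := admissible3_exists P P' gh.
rewrite (sigma_cE PP cZ gh ad) (sigma_cE PP' cZ gh ad').
have [a1 a2 a3] := ad; have [b1 b2 b3] := ad'.
by rewrite /kappa3 sub_combine -(aE g n m)// -(aE h m r)// -(aE _ n r).
Qed.

(** If c and c' differ by the coboundary of b, then at every level the two
    functions kappa differ by b(mu_g) - b(nu_g), up to values of b at segments
    of the two paths, which cancel along composable pairs. *)
Lemma gpdclass_cohomologous P c c' (s s' : gpdcocycle2 L A) :
  cyl_partition P -> catclass c = catclass c' ->
  s = sigma_c P c :> (_ -> _) -> s' = sigma_c P c' :> (_ -> _) ->
  gpdclass s = gpdclass s'.
Proof.
move=> PP /eqP; rewrite -Quotient.idealrBE unfold_in inE => -[b bC bE] sE sE'.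
have cZ := catcocycle2_Z2 c; have cZ' := catcocycle2_Z2 c'.
have cc' l m : src l = rng m -> c (l, m) - c' (l, m) = b l - b (comp l m) + b m.
  move=> lm; have := congr1 (fun f => f (l, m)) bE.
  by rewrite /catd1 /= asboolT// => ->.
have segE x n N : vle n N -> segval c x n N - segval c' x n N =
    b (seg x 0 n) - b (seg x 0 N) + b (seg x n (vsub N n)).
  move=> nN; rewrite /segval cc'; last by rewrite src_seg rng_seg add0r.
  by have := comp_seg x 0 n (vsub N n); rewrite add0r vsubK// => ->.
pose a g := b (pindex P g).1 - b (pindex P g).2.
have kE g N M : admissible P g N M -> kappa P c g N M - kappa P c' g N M =
    a g - (b (seg (gfst g) 0 N) - b (seg (glst g) 0 M)).
  move=> [lN aN]; have lp := pindex_level g PP.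
  have [bM E] := level_sub lp lN aN.
  have [s1 s2 _] := (cylP g (pindex_src g PP)).1 (pindexP g PP).2.
  have -> : kappa P c g N M - kappa P c' g N M =
      (segval c (gfst g) (deg (pindex P g).1) N -
       segval c' (gfst g) (deg (pindex P g).1) N) -
      (segval c (glst g) (deg (pindex P g).2) M -
       segval c' (glst g) (deg (pindex P g).2) M).
    by rewrite /kappa !opprD !opprK addrACA.
  rewrite !segE// E (level_tail _ lp) s1 s2 /a.
  by rewrite opprD addrACA subrr addr0 opprD addrACA -opprD.
apply: (@gpdclass_eq _ _ a).
  split.
    apply: locally_constant_continuous => g.
    have ad : admissible P g (deg (pindex P g).1) (deg (pindex P g).2).
      by split; [exact: pindex_level|exact: vle_refl].
    exists (level_cyl g (deg (pindex P g).1) (deg (pindex P g).2)).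
      exact: level_cyl_nbhs ad.1.
    by move=> g' g'U; have [E _ _] := kappa_local c PP ad g'U; rewrite /a E.
  move=> _ [x ->]; have := pindex_level (gunit x) PP => /level_unit E.
  have [s1 s2 _] := (cylP _ (pindex_src _ PP)).1 (pindexP (gunit x) PP).2.
  by rewrite /a -s1 -s2 E subrr.
move=> g h gh; rewrite sE sE'.
have [n [m [r [ad _]]]] := admissible3_exists P P gh.
rewrite (sigma_cE PP cZ gh ad) (sigma_cE PP cZ' gh ad).
have [a1 a2 a3] := ad.
rewrite /kappa3 sub_combine !kE// gfst_mul// glst_mul// gh.
set u := b _; set v := b _; set w := b _.
have E0 : (u - v) + (v - w) - (u - w) = 0.
  by rewrite [u - v + _]addrA subrK subrr.
by rewrite -sub_combine E0 subr0 addrAC.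
Qed.

(** * The homomorphism on cohomology *)

Definition sigma_cocycle P (PP : cyl_partition P) c : gpdcocycle2 L A :=
  GpdCocycle2 (mem_set (sigma_c_Z2 c PP)).

Lemma sigma_cocycleB P (PP : cyl_partition P) c c' :
  sigma_cocycle PP (c - c') = sigma_cocycle PP c - sigma_cocycle PP c'.
Proof.
apply: val_inj; apply/funext => -[g h].
rewrite -[LHS]/(sigma_c P (catcocycle2_fun (c - c')) (g, h)).
rewrite -[RHS]/(sigma_c P c (g, h) - sigma_c P c' (g, h)).
have [gh|ngh] := pselect (gcomposable (g, h)); last first.
  by rewrite !sigma_c_eq0// subrr.
have gh' := (gcomposableP g h).1 gh.
have [n [m [r [ad _]]]] := admissible3_exists P P gh'.
rewrite !(sigma_cE PP (catcocycle2_Z2 _) gh' ad) /kappa3 sub_combine.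
have kB f N M : kappa P (catcocycle2_fun (c - c')) f N M =
    kappa P c f N M - kappa P c' f N M.
  have cB p : catcocycle2_fun (c - c') p = c p - c' p by [].
  by rewrite /kappa /segval !cB !opprD !opprK addrACA.
by rewrite !kB [RHS]addrAC.
Qed.

(** The value at a class is computed on the chosen representative; [H2_mapE]
    shows that any representative gives the same value. *)
Definition H2_map P (PP : cyl_partition P) (q : catH2 L A) : gpdH2 L A :=
  gpdclass (sigma_cocycle PP (repr q)).

Lemma H2_mapE P (PP : cyl_partition P) c :
  H2_map PP (catclass c) = gpdclass (sigma_cocycle PP c).
Proof.
have E : catclass (repr (catclass c)) = catclass c.
  by rewrite {1}/catclass reprK.
by apply: (gpdclass_cohomologous PP E).
Qed.

Lemma H2_map_is_zmod_morphism P (PP : cyl_partition P) :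
  zmod_morphism (H2_map PP).
Proof.
move=> q q'; rewrite -(reprK q) -(reprK q').
have -> : \pi_(catH2 L A)%qT (repr q) - \pi_(catH2 L A)%qT (repr q') =
    catclass (repr q - repr q') by rewrite /catclass raddfB.
by rewrite !H2_mapE sigma_cocycleB /gpdclass raddfB.
Qed.

End GroupoidCocycle.

Theorem theorem6p5 (k : nat) (L : kgraph k) (A : topologicalZmodType)
    (L_row_finite : row_finite L) (L_no_sources : no_sources L)
    (A_lc : locally_compact [set: A]) :
  [/\ (* sigma_c is a continuous 2-cocycle *)
      forall (P : set (L * L)) (c : catcocycle2 L A),
        cyl_partition P -> gpdZ2 (sigma_c P c),
      (* its class does not depend on the partition *)
      forall (P P' : set (L * L)) (c : catcocycle2 L A)
          (s s' : gpdcocycle2 L A),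
        cyl_partition P -> cyl_partition P' ->
        s = sigma_c P c :> (_ -> _) -> s' = sigma_c P' c :> (_ -> _) ->
        gpdclass s = gpdclass s',
      (* and depends only on the class of c *)
      forall (P : set (L * L)) (c c' : catcocycle2 L A)
          (s s' : gpdcocycle2 L A),
        cyl_partition P -> catclass c = catclass c' ->
        s = sigma_c P c :> (_ -> _) -> s' = sigma_c P c' :> (_ -> _) ->
        gpdclass s = gpdclass s' &
      exists Phi : {additive catH2 L A -> gpdH2 L A},
        forall (P : set (L * L)) (c : catcocycle2 L A) (s : gpdcocycle2 L A),
          cyl_partition P -> s = sigma_c P c :> (_ -> _) ->
          Phi (catclass c) = gpdclass s].
Proof.
split.
- by move=> P c PP; exact: sigma_c_Z2.
- by move=> P P' c s s' PP PP'; exact: gpdclass_partition.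
- by move=> P c c' s s' PP; exact: gpdclass_cohomologous.
suff [F [FB FE]] : exists F : catH2 L A -> gpdH2 L A, zmod_morphism F /\
    forall (P : set (L * L)) (c : catcocycle2 L A) (s : gpdcocycle2 L A),
      cyl_partition P -> s = sigma_c P c :> (_ -> _) ->
      F (catclass c) = gpdclass s.
  pose M := GRing.isZmodMorphism.Build _ _ F FB.
  by pose Phi : {additive catH2 L A -> gpdH2 L A} := HB.pack F M; exists Phi.
have [[P0 PP0]|noP] := pselect (exists P : set (L * L), cyl_partition P).
  exists (H2_map PP0 (A := A)); split; first exact: H2_map_is_zmod_morphism.
  move=> P c s PP sE; rewrite H2_mapE.
  by apply: (gpdclass_partition PP0 PP _ sE).
(* In the absence of partitions the condition on the map is empty. *)
exists (fun=> 0); split=> [q q'|P c s PP]; first by rewrite subr0.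
by case: noP; exists P.
Qed.
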